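(* Let $(Q,\sigma)$ be a totally proper cyclically ordered quiver and let $v_j$ be a proper vertex in it. Let $U_Q$ be the unipotent companion of $Q$ with respect to a linear order $<$ associated to $\sigma$. (a) If $v_i<v_j$ for all $v_i\in\mathrm{In}(v_j)$, then $M_Q(v_j,-1)\,(U_Q+U_Q^T)\,M_Q(v_j,-1)^T$ is an admissible quasi-Cartan companion of $\mu_{v_j}(Q)$. (b) If $v_j<v_i$ for all $v_i\in\mathrm{Out}(v_j)$, then $M_Q(v_j,1)\,(U_Q+U_Q^T)\,M_Q(v_j,1)^T$ is an admissible quasi-Cartan companion of $\mu_{v_j}(Q)$.
   Context: A quiver is a finite directed graph with parallel edges (arrows) allowed and no oriented cycles of length 1 or 2; all vertices are mutable. Write $u\to v$ if there is at least one arrow from $u$ to $v$; $\mathrm{In}(v)=\{u: u\to v\}$, $\mathrm{Out}(v)=\{u: v\to u\}$. Exchange matrix: $B_Q=(b_{uv})$, $b_{uv}=\#\{\text{arrows }u\to v\}-\#\{\text{arrows }v\to u\}$. Mutation $\mu_v(Q)$: (1) for each oriented path $u\to v\to w$ add a new arrow $u\to w$ (with multiplicity); (2) reverse all arrows incident to $v$; (3) remove oriented 2-cycles one at a time until none remain. A cyclic ordering $\sigma$ is a linear ordering up to cyclic shifts; the linear orderings in this class are associated to $\sigma$. Moving clockwise means moving in the increasing direction (wrapping around). A cyclically ordered quiver (COQ) $(Q,\sigma)$ is a quiver with a cyclic ordering of its vertices. An oriented path $u\to v\to w$ makes a right turn at $v$ if $u<v<w$ in some linear order associated to $\sigma$;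 $v$ is proper if every oriented path $u\to v\to w$ makes a right turn at $v$. A wiggle fixes $Q$ and transposes two vertices adjacent in the cyclic ordering and not joined by an arrow of $Q$; wiggle equivalence is the generated equivalence relation. A COQ is proper if for every vertex $v$ there is a wiggle equivalent COQ in which $v$ is proper. To mutate a COQ at a proper vertex $v$, replace $Q$ by $\mu_v(Q)$ and move $v$ clockwise, from its original position, past all elements of $\mathrm{In}(v)$ (each once) without passing any element of $\mathrm{Out}(v)$, with In and Out computed in the mutated quiver (well defined up to wiggle equivalence). The proper mutation class of a COQ is the set of COQs obtainable by sequences of such proper mutations and wiggles. A COQ is totally proper if every COQ in its proper mutation class is proper. The unipotent companion of $(Q,<)$ is the unipotent upper triangular matrix $U$ with $U^T-U=B_Q$, rows and columns written in the order $<$. For a vertex $v$ and $\varepsilon=\pm1$, $M_Q(v,\varepsilon)=J+E$, where $J$ is diagonal with $J_{vv}=-1$ and $J_{qq}=1$ for $q\ne v$, and $E=(e_{pq})$ has $v$-th column $e_{qv}=\max(0,-\varepsilon b_{qv})$ and all other columns zero. All matrices are indexed by vertices. A quasi-Cartan companion of a quiver $R$ with exchange matrix $(b_{vw})$ is a symmetric matrix $A=(a_{vw})$ with $a_{vv}=2$ and $a_{vw}=\pm b_{vw}$ for $v\ne w$. $K_R$ is the underlying unoriented simple graph of $R$ (an edge $u-v$ whenever $R$ has any arrows between $u$ and $v$). A cycle in $K_R$ is a sequence $(w_0-w_1-\cdots-w_\ell=w_0)$ of consecutively adjacent vertices ($\ell\ge3$, $w_0,\dots,w_{\ell-1}$ distinct),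 up to cyclic shifts. It is chordless if there are no edges between $w_i$ and $w_j$ unless $i=j\pm1$ (indices modulo $\ell$), and oriented if either $w_i\to w_{i+1}$ in $R$ for all $i$ or $w_{i+1}\to w_i$ for all $i$. $A$ is admissible if for every chordless cycle in $K_R$ the number $\#\{0\le i<\ell : a_{w_iw_{i+1}}>0\}$ is odd when the cycle is oriented and even otherwise. *)

(* Defs.v *)
From Stdlib Require Import Relations.
From mathcomp Require Import all_boot all_order all_algebra.

Set Implicit Arguments.
Unset Strict Implicit.
Unset Printing Implicit Defensive.

Import GRing.Theory.
Local Open Scope ring_scope.

(* The vertex set is 'I_n.  The numerical order on 'I_n plays no role: the
   orders used below are always given explicitly, as listings of 'I_n. *)

Section Quivers.
Variable n : nat.

(* [a u v] is the number of arrows u -> v. *)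
Definition is_quiver (a : 'M[nat]_n) : bool :=
  [forall u, a u u == 0%N]
  && [forall u, forall v, ~~ ((0 < a u v)%N && (0 < a v u)%N)].

Record quiver := Quiver { arrows :> 'M[nat]_n; _ : is_quiver arrows }.

Definition arrow (Q : quiver) : rel 'I_n := fun u v => (0 < Q u v)%N.

Definition In_ (Q : quiver) (v : 'I_n) : {set 'I_n} := [set u | arrow Q u v].
Definition Out (Q : quiver) (v : 'I_n) : {set 'I_n} := [set u | arrow Q v u].

Definition exchange (Q : quiver) : 'M[int]_n :=
  \matrix_(u, v) ((Q u v)%:Z - (Q v u)%:Z).

Definition add_paths (v : 'I_n) (a : 'M[nat]_n) : 'M[nat]_n :=
  \matrix_(u, w) (a u w + a u v * a v w)%N.

Definition reverse_at (v : 'I_n) (a : 'M[nat]_n) : 'M[nat]_n :=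
  \matrix_(u, w) (if (u == v) || (w == v) then a w u else a u w).

(* Truncated subtraction: min(a u w, a w u) two-cycles are removed. *)
Definition cancel_2cycles (a : 'M[nat]_n) : 'M[nat]_n :=
  \matrix_(u, w) (a u w - a w u)%N.

Lemma cancel_2cycles_is_quiver a : is_quiver (cancel_2cycles a).
Proof.
apply/andP; split; apply/forallP => u; first by rewrite mxE subnn.
apply/forallP => v; rewrite !mxE !subn_gt0.
by case: (ltngtP (a u v) (a v u)).
Qed.

Definition mutate (v : 'I_n) (Q : quiver) : quiver :=
  Quiver (cancel_2cycles_is_quiver (reverse_at v (add_paths v Q))).

(* A linear ordering of the vertices is a duplicate-free n-tuple, listing them
   in increasing order. *)
Definition before (l : seq 'I_n) (u v : 'I_n) : bool :=
  (index u l < index v l)%N.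

Definition rotations (l : n.-tuple 'I_n) : {set n.-tuple 'I_n} :=
  [set rot_tuple k l | k : 'I_n.+1].

(* A cyclic ordering is a class of linear orderings modulo cyclic shifts;
   [l \in sigma] reads: l is associated to sigma. *)
Definition is_cyclic_ordering (S : {set n.-tuple 'I_n}) : bool :=
  [exists l : n.-tuple 'I_n, uniq l && (S == rotations l)].

Record cyclic_ordering := CyclicOrdering
  { associated :> {set n.-tuple 'I_n}; _ : is_cyclic_ordering associated }.

Definition coq : Type := (quiver * cyclic_ordering)%type.

Definition right_turn (C : coq) (u v w : 'I_n) : Prop :=
  exists2 l : n.-tuple 'I_n, l \in (C.2 : {set _}) & before l u v && before l v w.

Definition proper_vertex (C : coq) (v : 'I_n) : Prop :=
  forall u w, arrow C.1 u v -> arrow C.1 v w -> right_turn C u v w.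

Definition wiggle (C C' : coq) : Prop :=
  C'.1 = C.1 /\
  exists (l l' : n.-tuple 'I_n) (s t : seq 'I_n) (x y : 'I_n),
    [/\ l \in (C.2 : {set _}) /\ l' \in (C'.2 : {set _}),
        tval l = s ++ x :: y :: t, tval l' = s ++ y :: x :: t,
        ~~ arrow C.1 x y & ~~ arrow C.1 y x].

Definition wiggle_equivalent : coq -> coq -> Prop :=
  clos_refl_sym_trans coq wiggle.

Definition proper_coq (C : coq) : Prop :=
  forall v, exists2 C', wiggle_equivalent C C' & proper_vertex C' v.

(* The new position of v is determined only up to wiggles, so mutation of COQs
   is a relation.  Cutting the circle just before v, the vertex v moves
   clockwise past s and stops before t. *)
Definition coq_mutation (v : 'I_n) (C C' : coq) : Prop :=
  [/\ proper_vertex C v, C'.1 = mutate v C.1 &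
      exists (l l' : n.-tuple 'I_n) (s t : seq 'I_n),
        [/\ l \in (C.2 : {set _}) /\ l' \in (C'.2 : {set _}),
            tval l = v :: s ++ t, tval l' = s ++ v :: t,
            {subset In_ C'.1 v <= s} & {subset Out C'.1 v <= t}]].

Definition coq_step (C C' : coq) : Prop :=
  wiggle C C' \/ exists v, coq_mutation v C C'.

Definition in_proper_mutation_class (C C' : coq) : Prop :=
  clos_refl_trans coq coq_step C C'.

Definition totally_proper (C : coq) : Prop :=
  forall C', in_proper_mutation_class C C' -> proper_coq C'.

(* Upper triangularity refers to the order l; the entries themselves are
   indexed by vertices. *)
Definition unipotent_companion
    (Q : quiver) (l : seq 'I_n) (U : 'M[int]_n) : Prop :=
  [/\ forall v, U v v = 1,
      forall u v, before l v u -> U u v = 0 &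
      U^T - U = exchange Q].

Lemma unipotent_companion_exists_unique (Q : quiver) (l : n.-tuple 'I_n) :
  uniq l -> exists! U, unipotent_companion Q l U.
Proof.
move=> Ul.
have mem_l u : u \in l.
  have le_size : (size (enum 'I_n) <= size l)%N by rewrite size_enum_ord size_tuple.
  have sub_l : {subset l <= enum 'I_n} by move=> x _; rewrite mem_enum.
  by have [_ ->] := uniq_min_size Ul sub_l le_size; rewrite mem_enum.
have lt_total u v : u != v -> before l u v || before l v u.
  by move=> Nuv; rewrite /before -neq_ltn; apply: contra Nuv => /eqP/index_inj->.
exists (\matrix_(u, v) if u == v then 1
                       else if before l u v then - exchange Q u v else 0).
split.
  split=> [v | u v lt_vu |]; first by rewrite mxE eqxx.
    rewrite mxE; case: eqVneq lt_vu => [->|_]; rewrite /before ?ltnn //.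
    by move=> lt_vu; rewrite ltnNge ltnW.
  apply/matrixP=> u v; rewrite !mxE eq_sym.
  case: eqVneq => [->|Nuv]; first by rewrite !subrr.
  have := lt_total _ _ Nuv; rewrite /before.
  case: ltngtP => //= _ _; first by rewrite sub0r opprK.
  by rewrite subr0 opprB.
move=> U [U1 U0 UB]; apply/matrixP=> u v; rewrite mxE.
case: eqVneq => [->|Nuv]; first by rewrite U1.
have := lt_total _ _ Nuv; case: ifP => [lt_uv _ | _ /= lt_vu]; last by rewrite U0.
have /matrixP/(_ u v) := UB; rewrite 2!mxE [X in _ + X]mxE (U0 _ _ lt_uv) => <-.
by rewrite sub0r opprK.
Qed.

(* eps is meant to be 1 or -1. *)
Definition mut_matrix (Q : quiver) (v : 'I_n) (eps : int) : 'M[int]_n :=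
  (\matrix_(p, q) if p == q then (if p == v then -1 else 1) else 0)
  + \matrix_(p, q) (if q == v then Num.max 0 (- eps * exchange Q p v) else 0).

Definition quasi_Cartan_companion (R : quiver) (A : 'M[int]_n) : Prop :=
  [/\ A^T = A,
      forall v, A v v = 2 &
      forall v w, v != w ->
        A v w = exchange R v w \/ A v w = - exchange R v w].

Definition edge (R : quiver) : rel 'I_n := fun u v => arrow R u v || arrow R v u.

(* w = [:: w_0; ...; w_(l-1)] stands for (w_0 - w_1 - ... - w_l = w_0);
   [next w] sends w_i to w_(i+1), indices modulo l. *)
Definition graph_cycle (R : quiver) (w : seq 'I_n) : bool :=
  [&& (3 <= size w)%N, uniq w & cycle (edge R) w].

Definition chordless (R : quiver) (w : seq 'I_n) : Prop :=
  {in w &, forall x y, edge R x y -> y = next w x \/ x = next w y}.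

Definition oriented (R : quiver) (w : seq 'I_n) : bool :=
  cycle (arrow R) w || cycle (fun x y => arrow R y x) w.

Definition admissible_companion (R : quiver) (A : 'M[int]_n) : Prop :=
  quasi_Cartan_companion R A /\
  forall w, graph_cycle R w -> chordless R w ->
    odd (count (fun x => 0 < A x (next w x)) w) = oriented R w.

End Quivers.

(* Main.v *)
Require Import Defs.
From Stdlib Require Import Relations.
From mathcomp Require Import all_boot all_order all_algebra zify.

Set Implicit Arguments.
Unset Strict Implicit.
Unset Printing Implicit Defensive.

Import GRing.Theory Num.Theory Order.TTheory.
Local Open Scope ring_scope.

(** Off the diagonal, the entry of U + U^T at an edge u - v is positive exactly
    when the arrow between u and v goes backward in the chosen linear order.
    So admissibility of U + U^T says that the number of backward arrows on a
    chordless cycle is odd if the cycle is oriented and even otherwise.  This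
    parity depends only on the order up to switching, that is, up to reversing
    all comparisons between a set of vertices and its complement: a cycle
    crosses such a cut an even number of times.  Rotating a linear order is a
    switching, and a wiggle changes no comparison along an edge, so the parity
    can be read off in any order associated to any wiggle equivalent COQ.

    The parity statement [chordless_parity] holds for every totally proper COQ,
    by induction on the length of the cycle.  Wiggle so that a vertex v of the
    cycle is proper.  If the cycle passes through v along a path u -> v -> w,
    mutating at v replaces this path by an arrow u -> w; since u, v, w is a
    right turn, the number of backward arrows keeps its parity
    ([shortcut_parity]), and so does being oriented.  If v is a source or a sink
    of the cycle, mutating at v reverses its two arrows on the cycle and moves v
    past both neighbours or past none ([flip_parity]), after which a neighbour
    of v that was a source or a sink of the cycle is one no longer.  Triangles are settled by
    the right turn condition itself ([triangle_parity]).

    For the theorem, mutate (Q, sigma) at the given vertex v.  The result is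
    totally proper, so parity holds for mu_v(Q) and for every sign function
    switching equivalent to one of its linear orders
    ([signed_companion_admissible]).  An entrywise computation
    ([mut_matrix_conj_signed]) shows that the congruent matrix M (U + U^T) M^T
    comes from such a sign function: v has jumped over its in-neighbours in
    case (a), over its out-neighbours in case (b), and nothing else changed. *)

(** * Quivers, exchange matrices and mutation *)

Section QuiverBasics.
Variables (n : nat) (Q : quiver n).
Implicit Types u v w p q : 'I_n.

Lemma arrowxx u : arrow Q u u = false.
Proof.
case: Q => a quiver_a; rewrite /arrow /=.
by case/andP: quiver_a => /forallP/(_ u)/eqP -> _.
Qed.

Lemma arrow_antisym u v : arrow Q u v -> arrow Q v u = false.
Proof.
case: Q => a quiver_a; rewrite /arrow /=.
case/andP: quiver_a => _ /forallP/(_ u)/forallP/(_ v).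
by case: (0 < a v u)%N; rewrite ?andbT // => /negbTE ->.
Qed.

Lemma edge_sym u v : edge Q u v = edge Q v u.
Proof. by rewrite /edge orbC. Qed.

Lemma edge_neq u v : edge Q u v -> u != v.
Proof. by apply: contraL => /eqP ->; rewrite /edge arrowxx. Qed.

Lemma edge_arrowN u v : edge Q u v -> arrow Q v u = ~~ arrow Q u v.
Proof.
rewrite /edge; case: (boolP (arrow Q u v)) => [/arrow_antisym-> //|_] /= ->.
by [].
Qed.

Lemma exchange_anti u v : exchange Q v u = - exchange Q u v.
Proof. by rewrite !mxE opprB. Qed.

Lemma arrow_count u v : (Q u v)%:Z = Num.max 0 (exchange Q u v).
Proof.
have := @arrow_antisym u v; rewrite mxE /arrow; case: (Q u v) => [|a] H.
  by rewrite sub0r; apply/esym/max_l; rewrite oppr_le0.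
have -> : Q v u = 0%N by have := H isT; case: (Q v u).
by rewrite subr0 max_r.
Qed.

Lemma arrow_exchange u v : arrow Q u v = (0 < exchange Q u v).
Proof. by have := arrow_count u v; rewrite /arrow; lia. Qed.

End QuiverBasics.

Section Mutation.
Variables (n : nat) (Q : quiver n).
Implicit Types u v w p q : 'I_n.

Lemma exchange_mutate v p q : exchange (mutate v Q) p q =
  if (p == v) || (q == v) then - exchange Q p q
  else exchange Q p q + (Q p v)%:Z * (Q v q)%:Z - (Q q v)%:Z * (Q v p)%:Z.
Proof.
have Qvv : Q v v = 0%N by have := arrowxx Q v; rewrite /arrow; case: (Q v v).
rewrite !mxE [(q == v) || _]orbC.
by case: ifP => [/orP[]/eqP->|_]; rewrite ?Qvv; lia.
Qed.

Lemma arrow_mutate_out v q : arrow (mutate v Q) v q = arrow Q q v.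
Proof. by rewrite !arrow_exchange exchange_mutate eqxx -exchange_anti. Qed.

Lemma arrow_mutate_in v q : arrow (mutate v Q) q v = arrow Q v q.
Proof.
by rewrite !arrow_exchange exchange_mutate eqxx orbT -exchange_anti.
Qed.

Lemma exchange_mutate_off v p q : p != v -> q != v ->
    ~~ (arrow Q p v && arrow Q v q) -> ~~ (arrow Q q v && arrow Q v p) ->
  exchange (mutate v Q) p q = exchange Q p q.
Proof.
move=> /negbTE pv /negbTE qv; rewrite exchange_mutate pv qv /= /arrow.
by rewrite -!muln_gt0 -!eqn0Ngt -!PoszM => /eqP-> /eqP->; rewrite addr0 subr0.
Qed.

Lemma arrow_mutate_off v p q : p != v -> q != v ->
    ~~ (arrow Q p v && arrow Q v q) -> ~~ (arrow Q q v && arrow Q v p) ->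
  arrow (mutate v Q) p q = arrow Q p q.
Proof.
by move=> *; rewrite !arrow_exchange exchange_mutate_off ?exchange_mutate_off.
Qed.

Lemma arrow_mutate_through v p q : ~~ edge Q p q ->
  arrow Q p v -> arrow Q v q -> arrow (mutate v Q) p q.
Proof.
move=> nadj pv vq; rewrite arrow_exchange exchange_mutate.
have [/negbTE-> /negbTE->] : p != v /\ q != v.
  by split; [apply: contraTneq pv | apply: contraTneq vq] => ->; rewrite arrowxx.
move: nadj pv vq (arrow_antisym pv); rewrite /edge /arrow negb_or !mxE.
case: (Q p q) (Q q p) => [|?] [|?] // _; case: (Q v p) => // pv vq _.
by rewrite subrr add0r mulr0 subr0 -PoszM ltz_nat muln_gt0 pv.
Qed.

End Mutation.

(** * Linear orders up to switching *)

Section Switching.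
Variable T : eqType.
Implicit Types (e g : rel T).

(** The relations g play the role of strict linear orders; only their values on
    the pairs related by e matter.  In terms of symmetric matrices with the
    signs given by g, this is conjugation by a diagonal matrix of signs. *)
Definition switching e g g' : Prop :=
  exists h : pred T, forall x y, e x y -> g' x y = g x y (+) (h x (+) h y).

Lemma switching_sym e g g' : switching e g g' -> switching e g' g.
Proof. by case=> h gE; exists h => x y /gE ->; rewrite addbK. Qed.

Lemma switching_trans e g g' g'' :
  switching e g g' -> switching e g' g'' -> switching e g g''.
Proof.
case=> h gE [h' g'E]; exists (fun x => h x (+) h' x) => x y exy.
by rewrite g'E // gE // -addbA addbACA.
Qed.

Lemma sub_switching e e' g g' :
  subrel e e' -> switching e' g g' -> switching e g g'.
Proof. by move=> ee' [h gE]; exists h => x y /ee'/gE. Qed.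

End Switching.

Section Orders.
Variable n : nat.
Implicit Types (l : n.-tuple 'I_n) (s t : seq 'I_n) (sigma : cyclic_ordering n)
  (p q u v w x y z : 'I_n).

Lemma mem_ordering l x : uniq l -> x \in tval l.
Proof.
move=> Ul; have sub_l : {subset l <= enum 'I_n} by move=> y _; rewrite mem_enum.
have le_size : (size (enum 'I_n) <= size l)%N by rewrite size_enum_ord size_tuple.
by have [_ ->] := uniq_min_size Ul sub_l le_size; rewrite mem_enum.
Qed.

Lemma before_anti l x y : uniq l -> x != y -> before l y x = ~~ before l x y.
Proof.
move=> Ul nxy; rewrite /before; case: ltngtP => // /index_inj eq_xy.
by case/eqP: nxy; apply/esym/eq_xy => //; apply: mem_ordering.
Qed.

Lemma rotationsP l0 l :
  reflect (exists k, tval l = rot k l0) (l \in rotations l0).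
Proof.
apply: (iffP imsetP) => [[k _ ->]|[k lE]]; first by exists k.
exists (inord (minn k n)) => //; apply: val_inj.
by rewrite /= inordK ?ltnS ?geq_minr // lE rot_minn size_tuple.
Qed.

Lemma rotations_self l : l \in rotations l.
Proof. by apply/rotationsP; exists 0%N; rewrite rot0. Qed.

Lemma associatedP sigma :
  exists2 l0 : n.-tuple 'I_n, uniq l0 &
    forall l, l \in (sigma : {set _}) = (l \in rotations l0).
Proof.
by case: sigma => S /= /existsP[l0 /andP[Ul0 /eqP ->]]; exists l0.
Qed.

Lemma associated_uniq sigma l : l \in (sigma : {set _}) -> uniq l.
Proof.
have [l0 Ul0 ->] := associatedP sigma.
by case/rotationsP=> k ->; rewrite rot_uniq.
Qed.

Lemma associated_rot sigma l k :
  l \in (sigma : {set _}) -> rot_tuple k l \in (sigma : {set _}).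
Proof.
have [l0 Ul0 E] := associatedP sigma.
rewrite !E => /rotationsP[j lE]; apply/rotationsP.
by exists (rot_add l0 j k); rewrite /= lE rot_rot_add.
Qed.

(** The switched set consists of the first k entries: they jump over all the
    others and keep their relative order. *)
Lemma before_rot l k : uniq l ->
  switching (fun x y => x != y) (before l) (before (rot k l)).
Proof.
move=> Ul; exists [in take k l] => x y _.
have inl z : z \in take k l ++ drop k l by rewrite cat_take_drop mem_ordering.
move: Ul inl; rewrite -[in uniq _](cat_take_drop k l).
rewrite -[in before l](cat_take_drop k l) /rot /before.
move: (take k l) (drop k l) => a b; rewrite cat_uniq => /and3P[_ /hasPn dis _] inl.
have in_b z : (z \in b) = (z \notin a).
  move: (inl z) (dis z); rewrite mem_cat.
  by case: (z \in a); case: (z \in b) => // _ /(_ isT).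
rewrite !index_cat !in_b.
have := (@index_mem _ x a, @index_mem _ x b, @index_mem _ y a, @index_mem _ y b).
rewrite !in_b /= => -[[[]]].
by case: (x \in a); case: (y \in a); rewrite /= ?addbF ?addbT; lia.
Qed.

Lemma associated_switching sigma l l' :
    l \in (sigma : {set _}) -> l' \in (sigma : {set _}) ->
  switching (fun x y => x != y) (before l) (before l').
Proof.
have [l0 Ul0 E] := associatedP sigma; rewrite !E.
case/rotationsP=> k -> /rotationsP[k' ->].
by apply: switching_trans (before_rot k' Ul0); apply/switching_sym/before_rot.
Qed.

(** Each switched vertex of a triangle reverses two of its three comparisons. *)
Lemma switching_cyclic g g' x y z :
    switching (fun x y : 'I_n => x != y) g g' -> x != y -> y != z -> z != x ->
  g' x y (+) g' y z (+) g' z x = g x y (+) g y z (+) g z x.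
Proof.
case=> h gE nxy nyz nzx; rewrite !gE //.
by case: (h x); case: (h y); case: (h z);
  case: (g x y); case: (g y z); case: (g z x).
Qed.

Lemma before_transP l x y z :
  before l x y -> before l y z -> [/\ x != y, y != z & before l x z].
Proof.
rewrite /before => xy yz; split; last exact: ltn_trans yz.
  by apply: contraTneq xy => ->; rewrite ltnn.
by apply: contraTneq yz => ->; rewrite ltnn.
Qed.

(** In a linear order, u, v, w occur clockwise in this order exactly when two
    of u < v, v < w, w < u hold; otherwise only one does. *)
Lemma right_turn_parity (C : coq n) l u v w : l \in (C.2 : {set _}) ->
  right_turn C u v w -> before l u v (+) before l v w (+) before l w u = false.
Proof.
move=> lC [l' l'C /andP[uv vw]]; have Ul' := associated_uniq l'C.
have [nuv nvw uw] := before_transP uv vw.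
have nuw : u != w by apply: contraTneq uw => ->; rewrite /before ltnn.
rewrite (switching_cyclic (associated_switching l'C lC)) ?uv ?vw //.
  by rewrite (before_anti Ul' nuw) uw.
by rewrite eq_sym.
Qed.

(** Cutting the circle just after v makes v the last vertex. *)
Lemma associated_last sigma l v : l \in (sigma : {set _}) ->
  exists2 l2 : n.-tuple 'I_n, l2 \in (sigma : {set _}) &
    exists m, tval l2 = rcons m v.
Proof.
move=> lS; have Ul := associated_uniq lS; have vl := mem_ordering v Ul.
exists (rot_tuple (index v l).+1 l); first exact: associated_rot.
exists (drop (index v l).+1 l ++ take (index v l) l) => /=.
rewrite /rot (take_nth v) ?index_mem // nth_index //.
by rewrite rcons_cat.
Qed.

Lemma before_remove s t v p q : p != v -> q != v ->
  before (s ++ v :: t) p q = before (s ++ t) p q.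
Proof.
move=> pv qv; rewrite /before !index_cat /= ![v == _]eq_sym.
rewrite (negbTE pv) (negbTE qv).
move: (index_mem p s) (index_mem q s).
case: (p \in s); case: (q \in s);
by move: (index p s) (index q s) (index p t) (index q t) (size s); lia.
Qed.

Lemma before_transpose s t x y p q :
    (p == x) && (q == y) = false -> (p == y) && (q == x) = false ->
  before (s ++ y :: x :: t) p q = before (s ++ x :: y :: t) p q.
Proof.
rewrite /before !index_cat /= ![x == _]eq_sym ![y == _]eq_sym.
move: (index_mem p s) (index_mem q s).
move: (index p s) (index q s) (index p t) (index q t) (size s) => a b c d k.
case: (p \in s); case: (q \in s).
all: case: (eqVneq p x) (eqVneq p y) (eqVneq q x) (eqVneq q y).
all: move=> ? [] ? [] ? [] ? //=; try lia.
all: subst => //.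
Qed.

End Orders.

(** * Wiggles and proper mutations *)

Section Moves.
Variable n : nat.
Implicit Types (C : coq n) (Q : quiver n) (u v w p q : 'I_n) (l : n.-tuple 'I_n).

Lemma wiggle_sym C C' : wiggle C C' -> wiggle C' C.
Proof.
case=> E [l [l' [s [t [x [y [[lC l'C] lE l'E xy yx]]]]]]]; split=> //.
by exists l', l, s, t, y, x; rewrite E.
Qed.

Lemma wiggle_switching C C' l l' : wiggle C C' ->
    l \in (C.2 : {set _}) -> l' \in (C'.2 : {set _}) ->
  switching (edge C.1) (before l) (before l').
Proof.
case=> _ [l1 [l1' [s [t [x [y [[l1C l1'C] l1E l1'E xy yx]]]]]]] lC l'C.
have sub : subrel (edge C.1) (fun p q => p != q) by move=> p q /edge_neq.
apply: switching_trans (sub_switching sub (associated_switching lC l1C)) _.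
apply: switching_trans (sub_switching sub (associated_switching l1'C l'C)).
exists xpred0 => p q pq; rewrite l1E l1'E before_transpose /= ?addbF //.
  by apply: contraTF pq => /andP[/eqP-> /eqP->]; rewrite negb_or xy.
by apply: contraTF pq => /andP[/eqP-> /eqP->]; rewrite negb_or yx.
Qed.

Lemma associated_ex (sigma : cyclic_ordering n) :
  exists l : n.-tuple 'I_n, l \in (sigma : {set _}).
Proof.
by have [l0 _ E] := associatedP sigma; exists l0; rewrite E rotations_self.
Qed.

Lemma wiggle_equivalent_switching C C' : wiggle_equivalent C C' ->
  C'.1 = C.1 /\
  forall l l', l \in (C.2 : {set _}) -> l' \in (C'.2 : {set _}) ->
    switching (edge C.1) (before l) (before l').
Proof.
elim=> {C C'} [C C' W | C | C C' _ [E W] | C C' C'' _ [E W] _ [E' W']].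
- by split=> [|l l' lC l'C]; [case: W | apply: wiggle_switching W _ _].
- split=> // l l' lC l'C; apply: sub_switching (associated_switching lC l'C).
  by move=> p q /edge_neq.
- by split=> // l l' lC l'C; rewrite E; apply/switching_sym/W.
split=> [|l l'' lC l''C]; first by rewrite E' E.
have [l' l'C] := associated_ex C'.2.
by apply: switching_trans (W _ _ lC l'C) _; rewrite -E; apply: W'.
Qed.

Lemma wiggle_equivalent_class C C' : wiggle_equivalent C C' ->
  in_proper_mutation_class C C'.
Proof.
move=> W.
suff [] : in_proper_mutation_class C C' /\ in_proper_mutation_class C' C by [].
elim: W => {C C'} [C C' W | C | C C' _ [] | C C' C'' _ [H1 H2] _ [H3 H4]] //.
- by split; apply: rt_step; left; last exact: wiggle_sym.
- by split; apply: rt_refl.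
by split; [apply: rt_trans H3 | apply: rt_trans H2].
Qed.

Lemma totally_proper_class C C' :
  totally_proper C -> in_proper_mutation_class C C' -> totally_proper C'.
Proof. by move=> TP CC' C'' C'C''; apply: TP; apply: rt_trans C'C''. Qed.

(** Wiggles leave the quiver and all comparisons along its edges unchanged up to
    switching, so a vertex may be assumed proper in statements about these. *)
Lemma totally_proper_vertex C v : totally_proper C ->
  exists C', [/\ totally_proper C', proper_vertex C' v, C'.1 = C.1 &
    forall l l', l \in (C.2 : {set _}) -> l' \in (C'.2 : {set _}) ->
      switching (edge C.1) (before l) (before l')].
Proof.
move=> TP; have [C' W pv] := TP _ (rt_refl _ _ _) v.
have [E S] := wiggle_equivalent_switching W.
exists C'; split=> //; apply: totally_proper_class TP _.
exact: wiggle_equivalent_class.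
Qed.

Lemma is_cyclic_rotations (l : n.-tuple 'I_n) :
  uniq l -> is_cyclic_ordering (rotations l).
Proof. by move=> Ul; apply/existsP; exists l; rewrite Ul eqxx. Qed.

Definition cyclic_of (l : n.-tuple 'I_n) (Ul : uniq l) :=
  CyclicOrdering (is_cyclic_rotations Ul).

(** List the circle starting just after v, as l2.  Since v is proper, all of
    Out v comes before all of In v.  After the mutation In and Out are exchanged,
    so v has to stop between the two sets; l' is the resulting list. *)
Lemma mutation_exists Q (sigma : cyclic_ordering n) v :
    proper_vertex (Q, sigma) v ->
  exists (sigma' : cyclic_ordering n) (l2 l' : n.-tuple 'I_n),
  [/\ coq_mutation v (Q, sigma) (mutate v Q, sigma') /\ l2 \in (sigma : {set _}),
      l' \in (sigma' : {set _}) /\ (forall p, p != v -> before l2 p v),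
      forall p q, p != v -> q != v -> before l' p q = before l2 p q,
      forall u w, arrow Q u v -> arrow Q v w -> before l2 w u &
      (forall u, arrow Q u v -> before l' v u) /\
      (forall w, arrow Q v w -> before l' w v)].
Proof.
move=> pv; have [l0 l0S] := associated_ex sigma.
have [l2 l2S [m l2E]] := associated_last v l0S.
have Ul2 := associated_uniq l2S.
have Um : uniq (rcons m v) by rewrite -l2E.
have [vm um] : v \notin m /\ uniq m by move: Um; rewrite rcons_uniq => /andP[].
have szm : (size m).+1 = n by have := size_tuple l2; rewrite l2E size_rcons.
have inm p : p != v -> p \in m.
  by have := mem_ordering p Ul2; rewrite l2E mem_rcons inE => /orP[->|].
have before_last p : p != v -> before l2 p v.
  move=> pv'; rewrite l2E /before -cats1 !index_cat inm // (negbTE vm) /= eqxx.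
  by rewrite addn0 index_mem inm.
have out_in u w : arrow Q u v -> arrow Q v w -> before l2 w u.
  move=> uv vw; have turn := pv _ _ uv vw.
  have := @right_turn_parity _ (Q, sigma) _ _ _ _ l2S turn.
  have nu : u != v by apply: contraTneq uv => ->; rewrite arrowxx.
  have nw : w != v by apply: contraTneq vw => ->; rewrite arrowxx.
  by rewrite before_last // (before_anti Ul2 nw) before_last //; case: before.
(* The new place of v is just before the first of its in-neighbours. *)
pose k := find (fun u => arrow Q u v) m.
pose s := take k m; pose t := drop k m.
have mE : m = s ++ t by rewrite cat_take_drop.
have In_t u : arrow Q u v -> u \in t.
  move=> uv; have : u \in m.
    by apply: inm; apply: contraTneq uv => ->; rewrite arrowxx.
  rewrite mE mem_cat => /orP[us|//].
  have := @before_find _ v (fun u => arrow Q u v) m (index u m).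
  have lt_uk : (index u m < k)%N.
    rewrite mE index_cat us; apply: leq_trans (_ : size s <= _)%N.
      by rewrite index_mem.
    by rewrite size_take_min geq_minl.
  have um' : u \in m by rewrite mE mem_cat us.
  by rewrite nth_index // uv => /(_ lt_uk).
have Out_s w : arrow Q v w -> w \in s.
  move=> vw; have : w \in m.
    by apply: inm; apply: contraTneq vw => ->; rewrite arrowxx.
  rewrite mE mem_cat => /orP[//|wt].
  have hasI : has (fun u => arrow Q u v) m.
    rewrite has_find -/k ltnNge; apply: contraL wt => le_mk.
    by rewrite /t drop_oversize.
  have := out_in _ _ (nth_find v hasI) vw; rewrite /before -/k l2E -cats1.
  have km : (k < size m)%N by rewrite -has_find.
  rewrite !index_cat mem_nth // index_uniq // mE mem_cat wt orbT -mE.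
  rewrite {1}mE index_cat.
  have -> : (w \in s) = false.
    by move: um; rewrite mE cat_uniq => /and3P[_ /hasPn/(_ _ wt)/negbTE].
  by rewrite size_take km; lia.
have sz1 : size (v :: s ++ t) == n by rewrite -mE /= szm.
have sz' : size (s ++ v :: t) == n.
  by rewrite size_cat /= addnS -size_cat -mE szm.
pose l1 : n.-tuple 'I_n := Tuple sz1.
pose l' : n.-tuple 'I_n := Tuple sz'.
have Ul' : uniq l' by rewrite /= -cat1s uniq_catCA -mE uniq_catC cats1.
exists (cyclic_of Ul'), l2, l'; split=> //.
- split=> //; split=> //.
  exists l1, l', s, t; split=> //.
  + split; last exact: rotations_self.
    have -> : l1 = rot_tuple (size m) l2.
      by apply: val_inj; rewrite /= l2E -cats1 rot_size_cat mE.
    exact: associated_rot.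
  + by move=> p; rewrite inE /= arrow_mutate_in => /Out_s.
  by move=> p; rewrite inE /= arrow_mutate_out => /In_t.
- by split=> //; apply: rotations_self.
- move=> p q pv' qv'; rewrite /= before_remove // -mE l2E -cats1.
  by rewrite before_remove // cats0.
have vs : v \in s = false.
  by apply: contraNF vm; rewrite mE mem_cat => ->.
split=> [u uv | w vw]; rewrite /before !index_cat vs /= eqxx addn0.
  have -> : u \in s = false.
    by move: um; rewrite mE cat_uniq => /and3P[_ /hasPn/(_ _ (In_t _ uv))/negbTE].
  have -> : (v == u) = false.
    by apply: contraTF uv => /eqP ->; rewrite arrowxx.
  by lia.
by rewrite Out_s // index_mem Out_s.
Qed.

End Moves.

(** * Parity of a sign function along a cycle *)

Section CycleParity.
Variable T : eqType.
Implicit Types (f : rel T) (e : rel T) (x y : T) (w s : seq T).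

Definition cycle_parity f w := odd (count (fun x => f x (next w x)) w).

Fixpoint path_parity f x s :=
  if s is y :: s' then f x y (+) path_parity f y s' else false.

Lemma path_parity_rcons f x s y :
  path_parity f x (rcons s y) = path_parity f x s (+) f (last x s) y.
Proof. by elim: s x => [|z s IH] x /=; rewrite ?addbF // IH addbA. Qed.

Lemma cycle_parity_path f x s : uniq (x :: s) ->
  cycle_parity f (x :: s) = path_parity f x s (+) f (last x s) x.
Proof.
move=> Us; have := cycle_next Us; rewrite -path_parity_rcons /cycle_parity.
move: (next (x :: s)) => h; rewrite [cycle _ _]/= -(belast_rcons x s x).
move: (rcons s x) => t; elim: t x {Us} => //= z t IH y /andP[/eqP hy pz].
by rewrite oddD oddb IH // hy.
Qed.

Lemma cycle_parity_rot f k w : uniq w ->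
  cycle_parity f (rot k w) = cycle_parity f w.
Proof.
move=> Uw; rewrite /cycle_parity; congr odd; rewrite (permP (permEl (perm_rot k w))).
by apply: eq_count => x; rewrite next_rot.
Qed.

Lemma eq_path_parity e f f' x s : path e x s ->
    {in x :: s &, forall y z, e y z -> f y z = f' y z} ->
  path_parity f x s = path_parity f' x s.
Proof.
elim: s x => //= y s IH x /andP[exy pys] ff'.
rewrite (ff' x y) ?inE ?eqxx ?orbT //; congr (_ (+) _).
by apply: IH pys _ => u v us vs; apply: ff'; rewrite inE ?us ?vs orbT.
Qed.

Lemma eq_path_on e f f' x s : path e x s ->
    {in x :: s &, forall y z, e y z -> f y z = f' y z} ->
  path f x s = path f' x s.
Proof.
elim: s x => //= y s IH x /andP[exy pys] ff'.
rewrite (ff' x y) ?inE ?eqxx ?orbT //; congr (_ && _).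
by apply: IH pys _ => u v us vs; apply: ff'; rewrite inE ?us ?vs orbT.
Qed.

(** The switching terms telescope along the cycle. *)
Lemma switching_cycle_parity e g g' (a : rel T) w : uniq w -> cycle e w ->
    switching e g g' ->
  cycle_parity (fun x y => g' x y (+) a x y) w =
  cycle_parity (fun x y => g x y (+) a x y) w.
Proof.
case: w => // x s Us Cs [h gE]; rewrite !cycle_parity_path //.
rewrite -(path_parity_rcons (fun x y => g' x y (+) a x y)).
rewrite -(path_parity_rcons (fun x y => g x y (+) a x y)).
suff aux t y : path e y t -> path_parity (fun x y => g' x y (+) a x y) y t =
    path_parity (fun x y => g x y (+) a x y) y t (+) (h y (+) h (last y t)).
  by rewrite aux // last_rcons addbb addbF.
elim: t y => [|z t IH] y /=; first by rewrite addbb.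
move=> /andP[/gE-> /IH->].
move: (path_parity _ z t) (h (last z t)) (h y) (h z) => A B c d.
by case: (g y z); case: (a y z); case: A; case: B; case: c; case: d.
Qed.

(** Deleting v from the cycle changes the successor of its predecessor only. *)
Lemma next_tail v x s : uniq (v :: x :: s) ->
  [/\ next (v :: x :: s) v = x, next (v :: x :: s) (last x s) = v,
      next (x :: s) (last x s) = x &
      {in belast x s, forall z, next (v :: x :: s) z = next (x :: s) z}].
Proof.
move=> Uw; have Us : uniq (x :: s) by case/andP: Uw.
move: (cycle_next Us) (cycle_next Uw).
move: (next (v :: x :: s)) (next (x :: s)) => h h' /=; rewrite !rcons_path /=.
move=> /andP[p1 /eqP E1] /and3P[/eqP E2 p2 /eqP E3]; split=> //.
elim: s x {Uw Us E1 E2 E3} p1 p2 => //= y s IH x /andP[/eqP h'x p1] /andP[/eqP hx p2].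
by move=> z; rewrite inE => /orP[/eqP->|/(IH _ p1 p2) //]; rewrite hx h'x.
Qed.

End CycleParity.

(** * Chordless cycles in totally proper quivers *)

Section Chordless.
Variable n : nat.
Implicit Types (C : coq n) (Q : quiver n) (u v p q x y : 'I_n) (s w : seq 'I_n)
  (l : n.-tuple 'I_n).

Definition chordless_cycle Q w := graph_cycle Q w /\ chordless Q w.

Lemma chordless_cycle_rot Q k w :
  chordless_cycle Q w -> chordless_cycle Q (rot k w).
Proof.
case=> /and3P[sz Uw Cw] ch; split.
  by rewrite /graph_cycle size_rot rot_uniq rot_cycle; apply/and3P.
by move=> x y; rewrite !mem_rot !next_rot //; apply: ch.
Qed.

Lemma oriented_rot Q k w : oriented Q (rot k w) = oriented Q w.
Proof. by rewrite /oriented !rot_cycle. Qed.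

Definition through Q x v y :=
  (arrow Q x v && arrow Q v y) || (arrow Q y v && arrow Q v x).

Section Head.
Variables (Q : quiver n) (v x : 'I_n) (s : seq 'I_n).
Hypothesis cyc : chordless_cycle Q (v :: x :: s).

Lemma head_uniq : uniq (v :: x :: s). Proof. by case: cyc => /and3P[]. Qed.

Lemma head_tail_uniq : uniq (x :: s). Proof. by case/andP: head_uniq. Qed.

Lemma head_tail_neq p : p \in x :: s -> p != v.
Proof. by move=> ps; apply: contraTneq ps => ->; case/andP: head_uniq. Qed.

Lemma head_edges : [/\ edge Q v x, path (edge Q) x s & edge Q (last x s) v].
Proof.
by case: cyc => /and3P[_ _ /=]; rewrite rcons_path => /and3P[].
Qed.

Lemma head_last_neq : (4 <= size (v :: x :: s))%N -> x != last x s.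
Proof.
move=> sz; have := head_tail_uniq; move: sz; case: (s) => //= y s' _ /andP[].
by move=> nx _; apply: contraNneq nx => ->; apply: mem_last.
Qed.

Lemma head_adjacent p : p \in x :: s -> edge Q v p -> p = x \/ p = last x s.
Proof.
move=> ps vp; have [E1 E2 _ _] := next_tail head_uniq.
have [_ ch] := cyc; have pw : p \in v :: x :: s by rewrite inE ps orbT.
case: (ch v p (mem_head _ _) pw vp); rewrite ?E1; first by left.
by move=> E; right; apply: (can_inj (prev_next head_uniq)); rewrite E2 -E.
Qed.

(** The two neighbours of v on the cycle would be joined by a chord. *)
Lemma head_no_triangle p q : (4 <= size (v :: x :: s))%N ->
    p \in x :: s -> q \in x :: s -> edge Q p q -> edge Q v p -> edge Q v q ->
  False.
Proof.
move=> sz; wlog: p q / p = x => [W ps qs pq vp vq|-> _ qs xq _ vq].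
  case: (head_adjacent ps vp) => pE; first exact: W pE ps qs pq vp vq.
  case: (head_adjacent qs vq) => qE; first by apply: W qE qs ps _ vq vp; rewrite edge_sym.
  by have := edge_neq pq; rewrite pE qE eqxx.
have nxq : x != q by apply: edge_neq xq.
case: (head_adjacent qs vq) => qE; first by rewrite qE eqxx in nxq.
have [E1 E2 _ _] := next_tail head_uniq.
have [_ ch] := cyc; have qw : q \in v :: x :: s by rewrite inE qs orbT.
have xw : x \in v :: x :: s by rewrite !inE eqxx orbT.
case: (ch x q xw qw xq).
  have := head_tail_uniq; have := head_uniq; move: qE sz; case: (s) => //= y s'.
  move=> -> sz Uw /and3P[_ ny _]; rewrite (negbTE (head_tail_neq (mem_head _ _))).
  rewrite eqxx => E; case/negP: ny; case: (s') sz E => //= z s'' _ <-.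
  exact: mem_last.
by rewrite qE E2 => E; have := head_tail_neq (mem_head x s); rewrite E eqxx.
Qed.

(** An edge of the cycle away from v could only be affected by a path through v
    with the same end points, and would then form a triangle with v. *)
Lemma head_arrow_mutate p q : (4 <= size (v :: x :: s))%N ->
    p \in x :: s -> q \in x :: s -> edge Q p q ->
  arrow (mutate v Q) p q = arrow Q p q.
Proof.
move=> sz ps qs pq; have tri := head_no_triangle sz ps qs pq.
by apply: arrow_mutate_off; rewrite ?head_tail_neq //; apply/negP => /andP[A B];
  apply: tri; rewrite /edge ?A ?B ?orbT.
Qed.

End Head.

Lemma edge_mutate Q v p q : p != v -> q != v -> edge (mutate v Q) p q ->
  edge Q p q \/ through Q p v q.
Proof.
move=> pv qv; rewrite /through; case: orP => [_ _|nth]; first by right.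
have [A B] : ~~ (arrow Q p v && arrow Q v q) /\ ~~ (arrow Q q v && arrow Q v p).
  by split; apply/negP => H; apply: nth; [left | right].
by rewrite /edge !arrow_mutate_off //; left.
Qed.

Lemma through_edges Q p v q : through Q p v q -> edge Q v p /\ edge Q v q.
Proof. by rewrite /edge => /orP[] /andP[-> ->]; rewrite !orbT. Qed.

(** The path through v is replaced by an arrow.  The only new adjacency within
    the cycle is between the two neighbours of v, which become consecutive. *)
Lemma chordless_shortcut Q v x s : (4 <= size (v :: x :: s))%N ->
    chordless_cycle Q (v :: x :: s) -> through Q (last x s) v x ->
  chordless_cycle (mutate v Q) (x :: s) /\
  oriented (mutate v Q) (x :: s) = oriented Q (v :: x :: s).
Proof.
move=> sz cyc thr; have [vx pxs lv] := head_edges cyc.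
have xs : x \in x :: s := mem_head _ _; have ls := mem_last x s.
have nE : ~~ edge Q (last x s) x.
  apply/negP=> E; apply: (head_no_triangle cyc sz ls xs E) => //.
  by rewrite edge_sym.
have nE' : ~~ edge Q x (last x s) by rewrite edge_sym.
have agree := head_arrow_mutate cyc sz.
have path_eq : path (arrow (mutate v Q)) x s = path (arrow Q) x s.
  by apply: eq_path_on pxs _ => p q ps qs; apply: agree.
have path_eq' : path (fun p q => arrow (mutate v Q) q p) x s =
                path (fun p q => arrow Q q p) x s.
  by apply: eq_path_on pxs _ => p q ps qs pq; apply: agree; rewrite // edge_sym.
have edge' : edge (mutate v Q) (last x s) x.
  case/orP: thr => /andP[A B]; rewrite /edge (arrow_mutate_through _ A B) ?orbT //.
split; last first.
  rewrite /oriented /= !rcons_path path_eq path_eq'.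
  case/orP: thr => /andP[A B]; have := arrow_mutate_through _ A B.
    move=> /(_ nE) C; rewrite A B C (arrow_antisym A) (arrow_antisym B).
    by rewrite (arrow_antisym C) !andbF !andbT.
  move=> /(_ nE') C; rewrite A B C (arrow_antisym A) (arrow_antisym B).
  by rewrite (arrow_antisym C) !andbF !andbT.
have [E1 E2 E3 E4] := next_tail (head_uniq cyc).
split.
  rewrite /graph_cycle (head_tail_uniq cyc) /= rcons_path edge' andbT.
  apply/andP; split=> //.
  rewrite (@eq_path_on _ (edge Q) _ (edge Q)) // => p q ps qs pq.
  by rewrite /edge !agree // edge_sym.
have nextP p q : p \in x :: s -> q \in x :: s ->
    q = next (v :: x :: s) p -> q = next (x :: s) p.
  rewrite {1}lastI mem_rcons inE => /orP[/eqP->|/E4-> //].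
  by rewrite E2 => qs E; have := head_tail_neq cyc qs; rewrite E eqxx.
move=> p q ps qs pq; have [_ ch] := cyc.
have npq := edge_neq pq.
have [pv qv] := (head_tail_neq cyc ps, head_tail_neq cyc qs).
have [E|/through_edges[vp vq]] := edge_mutate pv qv pq.
  have pw : p \in v :: x :: s by rewrite inE ps orbT.
  have qw : q \in v :: x :: s by rewrite inE qs orbT.
  by case: (ch p q pw qw E); [left | right]; apply: nextP.
case: (head_adjacent cyc ps vp) (head_adjacent cyc qs vq) npq => -> [] ->.
- by rewrite eqxx.
- by right.
- by left.
- by rewrite eqxx.
Qed.


(** As v is a source or a sink of the cycle, no path through v joins two of its
    vertices: mutation creates no chord, and v remains a sink or a source, which
    excludes that the cycle is oriented. *)
Lemma chordless_flip Q v x s : (4 <= size (v :: x :: s))%N ->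
    chordless_cycle Q (v :: x :: s) -> ~~ through Q (last x s) v x ->
  chordless_cycle (mutate v Q) (v :: x :: s) /\
  ~~ oriented (mutate v Q) (v :: x :: s).
Proof.
move=> sz cyc nthr; have [vx pxs lv] := head_edges cyc.
have agree := head_arrow_mutate cyc sz.
have edge_at p : edge (mutate v Q) v p = edge Q v p.
  by rewrite /edge arrow_mutate_out arrow_mutate_in orbC.
split; last first.
  rewrite /oriented /= !rcons_path !arrow_mutate_out !arrow_mutate_in.
  by apply: contra nthr; rewrite /through => /orP[] /and3P[-> _ ->]; rewrite ?orbT.
have [/and3P[_ Uw _] ch] := cyc; split.
  rewrite /graph_cycle Uw /= rcons_path edge_at vx edge_sym edge_at edge_sym lv andbT.
  rewrite (@eq_path_on _ (edge Q) _ (edge Q)) ?pxs //.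
    by rewrite !andbT; apply: ltnW sz.
  move=> p q ps qs pq.
  by rewrite /edge !agree // edge_sym.
move=> p q pw qw pq; apply: ch => //.
case: (eqVneq p v) pq => [->|pv]; first by rewrite edge_at.
case: (eqVneq q v) => [->|qv]; first by rewrite edge_sym edge_at edge_sym.
move=> pq; have npq := edge_neq pq.
case: (edge_mutate pv qv pq) => // thr; have [vp vq] := through_edges thr.
have ps : p \in x :: s by move: pw; rewrite inE (negbTE pv).
have qs : q \in x :: s by move: qw; rewrite inE (negbTE qv).
case/negP: nthr.
case: (head_adjacent cyc ps vp) (head_adjacent cyc qs vq) npq thr => -> [] ->.
- by rewrite eqxx.
- by rewrite /through orbC.
- by [].
- by rewrite eqxx.
Qed.

(** Meaningful on edges x - y only, where exactly one of x -> y and y -> x holds: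
    the arrow goes forward when it points to the larger end point. *)
Definition backward l Q x y := before l x y (+) arrow Q x y.

(** Mutation at an arbitrary vertex v, after wiggling v into proper position.
    The order l2 is taken in the wiggled COQ and has v last. *)
Lemma totally_proper_mutate C l v : totally_proper C -> l \in (C.2 : {set _}) ->
  exists (C' : coq n) (l2 l' : n.-tuple 'I_n),
  [/\ [/\ totally_proper C', C'.1 = mutate v C.1 & l' \in (C'.2 : {set _})],
      switching (edge C.1) (before l) (before l2) /\ uniq l2 /\ uniq l',
      (forall p, p != v -> before l2 p v) /\
      forall p q, p != v -> q != v -> before l' p q = before l2 p q,
      forall u (w : 'I_n), arrow C.1 u v -> arrow C.1 v w -> before l2 w u &
      (forall u, arrow C.1 u v -> before l' v u) /\
      (forall w : 'I_n, arrow C.1 v w -> before l' w v)].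
Proof.
move=> TP lC; have [[Q sigma] [TP1 pv /= EQ sw]] := totally_proper_vertex v TP.
have [sigma' [l2 [l' [[mut l2S] [l'S last2] agree outin inout]]]] :=
  mutation_exists pv.
exists (mutate v Q, sigma'), l2, l'; rewrite -EQ; split=> //.
  split=> //; apply: totally_proper_class TP1 _.
  by apply: rt_step; right; exists v.
split; first by rewrite EQ; apply: sw.
by split; [apply: associated_uniq l2S | apply: associated_uniq l'S].
Qed.

(** Let u -> v -> w be the path through v.  In l2 the vertices w < u < v come in
    this order, so exactly one of u -> v and v -> w is backward, and so is the
    new arrow u -> w. *)
Lemma shortcut_parity C l v x s : totally_proper C -> l \in (C.2 : {set _}) ->
    (4 <= size (v :: x :: s))%N -> chordless_cycle C.1 (v :: x :: s) ->
    through C.1 (last x s) v x ->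
  exists (C' : coq n) (l' : n.-tuple 'I_n),
  [/\ totally_proper C', C'.1 = mutate v C.1, l' \in (C'.2 : {set _}) &
      cycle_parity (backward l' C'.1) (x :: s) =
      cycle_parity (backward l C.1) (v :: x :: s)].
Proof.
move=> TP lC sz cyc thr.
have [C' [l2 [l' [[TP' EQ' l'C'] [sw [Ul2 Ul']] [last2 agree] outin inout]]]] :=
  totally_proper_mutate v TP lC.
exists C', l'; split=> //.
have Uw := head_uniq cyc; have [vx pxs lv] := head_edges cyc.
have [/and3P[_ _ Cw] _] := cyc.
rewrite /backward -(switching_cycle_parity _ Uw Cw sw).
rewrite !cycle_parity_path ?(head_tail_uniq cyc) // [path_parity _ v _]/= EQ'.
rewrite (eq_path_parity pxs (_ : {in x :: s &, forall p q, edge C.1 p q -> _ =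
    before l2 p q (+) arrow C.1 p q})); last first.
  move=> p q ps qs pq; rewrite agree ?(head_tail_neq cyc) //.
  by rewrite (head_arrow_mutate cyc).
rewrite [X in _ = X (+) _]addbC -addbA; congr (_ (+) _).
have xv : x != v by apply: (head_tail_neq cyc); rewrite mem_head.
have lastv : last x s != v by apply: (head_tail_neq cyc); apply: mem_last.
have nxl := head_last_neq cyc sz.
rewrite agree // (last2 _ lastv) (before_anti Ul2 xv) (last2 _ xv).
have nE : ~~ edge C.1 (last x s) x.
  apply/negP=> E.
  apply: (head_no_triangle cyc sz (mem_last x s) (mem_head x s) E) => //.
  by rewrite edge_sym.
case/orP: thr => /andP[A B].
  rewrite (before_anti Ul2 nxl) (outin _ _ A B) A B.
  by rewrite arrow_mutate_through.
have C1 : arrow (mutate v C.1) x (last x s).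
  by rewrite arrow_mutate_through // edge_sym.
by rewrite (outin _ _ A B) (arrow_antisym C1) (arrow_antisym A) (arrow_antisym B).
Qed.

(** Both arrows at v are reversed.  In the passage from l2 to l', either both
    neighbours are out-neighbours and stay before v, or both are in-neighbours
    and end up after v; either way the changes at the two edges cancel. *)
Lemma flip_parity C l v x s : totally_proper C -> l \in (C.2 : {set _}) ->
    (4 <= size (v :: x :: s))%N -> chordless_cycle C.1 (v :: x :: s) ->
    ~~ through C.1 (last x s) v x ->
  exists (C' : coq n) (l' : n.-tuple 'I_n),
  [/\ totally_proper C', C'.1 = mutate v C.1, l' \in (C'.2 : {set _}) &
      cycle_parity (backward l' C'.1) (v :: x :: s) =
      cycle_parity (backward l C.1) (v :: x :: s)].
Proof.
move=> TP lC sz cyc nthr.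
have [C' [l2 [l' [[TP' EQ' l'C'] [sw [Ul2 Ul']] [last2 agree] _ [v_in out_v]]]]] :=
  totally_proper_mutate v TP lC.
exists C', l'; split=> //.
have Uw := head_uniq cyc; have [vx pxs lv] := head_edges cyc.
have [/and3P[_ _ Cw] _] := cyc.
rewrite /backward -(switching_cycle_parity _ Uw Cw sw).
rewrite !cycle_parity_path ?(head_tail_uniq cyc) // ![path_parity _ v _]/= EQ'.
rewrite (eq_path_parity pxs (_ : {in x :: s &, forall p q, edge C.1 p q -> _ =
    before l2 p q (+) arrow C.1 p q})); last first.
  move=> p q ps qs pq; rewrite agree ?(head_tail_neq cyc) //.
  by rewrite (head_arrow_mutate cyc).
rewrite [LHS]addbAC [RHS]addbAC /=; congr (_ (+) _).
have xv : x != v by apply: (head_tail_neq cyc); rewrite mem_head.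
have lastv : last x s != v by apply: (head_tail_neq cyc); apply: mem_last.
rewrite (last2 _ lastv) (before_anti Ul2 xv) (last2 _ xv).
rewrite arrow_mutate_out arrow_mutate_in (edge_arrowN vx).
have same : arrow C.1 v x = ~~ arrow C.1 (last x s) v.
  move: nthr; rewrite /through (edge_arrowN vx) (edge_arrowN lv).
  by case: (arrow C.1 v x); case: (arrow C.1 _ _).
case: (boolP (arrow C.1 v x)) same => [A | nA] /esym B.
  have A' : arrow C.1 v (last x s) by rewrite (edge_arrowN lv).
  by rewrite (before_anti Ul' xv) !out_v // A' (negbTE B).
have A : arrow C.1 x v by rewrite (edge_arrowN vx).
have A' : arrow C.1 (last x s) v by case: (arrow C.1 _ _) B.
rewrite v_in // (before_anti Ul' (_ : v != last x s)) 1?eq_sym // v_in //.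
by rewrite A' (arrow_antisym A').
Qed.

(** Wiggles preserve comparisons of adjacent vertices only up to switching,
    whence the parity form and the condition that u and w are joined too. *)
Lemma totally_proper_turn C l (u v w : 'I_n) : totally_proper C -> l \in (C.2 : {set _}) ->
    arrow C.1 u v -> arrow C.1 v w -> edge C.1 w u ->
  before l u v (+) before l v w (+) before l w u = false.
Proof.
move=> TP lC uv vw wu; have [C' [TP' pv EQ sw]] := totally_proper_vertex v TP.
have [l' l'C'] := associated_ex C'.2; have [h hE] := sw _ _ lC l'C'.
rewrite -EQ in uv vw wu; have := right_turn_parity l'C' (pv _ _ uv vw).
rewrite EQ in uv vw wu; rewrite !hE //; first last.
- by rewrite /edge uv.
- by rewrite /edge vw.
move: (h u) (h v) (h w) => a b c.
by case: (before l u v); case: (before l v w); case: (before l w u);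
  case: a; case: b; case: c.
Qed.

(** Whatever the orientations, some vertex of the triangle is neither a source
    nor a sink, and its right turn fixes the cyclic order of the three. *)
Lemma triangle_parity C l (x y z : 'I_n) : totally_proper C -> l \in (C.2 : {set _}) ->
    graph_cycle C.1 [:: x; y; z] ->
  cycle_parity (backward l C.1) [:: x; y; z] = oriented C.1 [:: x; y; z].
Proof.
move=> TP lC /and3P[_ Uw /and4P[xy yz zx _]].
have Ul := associated_uniq lC.
rewrite cycle_parity_path //= /oriented /backward /= addbF !andbT.
have turn (u v w : 'I_n) := @totally_proper_turn C l u v w TP lC.
have yx : edge C.1 y x by rewrite edge_sym.
have zy : edge C.1 z y by rewrite edge_sym.
have xz : edge C.1 x z by rewrite edge_sym.
move: (turn x y z) (turn y z x) (turn z x y) (turn z y x) (turn y x z) (turn x z y).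
rewrite xy yz zx yx zy xz.
rewrite (before_anti Ul (edge_neq xy)) (before_anti Ul (edge_neq yz)).
rewrite (before_anti Ul (edge_neq zx)).
rewrite (edge_arrowN xy) (edge_arrowN yz) (edge_arrowN zx).
case: (arrow C.1 x y); case: (arrow C.1 y z); case: (arrow C.1 z x);
case: (before l x y); case: (before l y z); case: (before l z x) => //=.
all: by do ?[move/(_ isT isT isT) => // | move=> _].
Qed.

(** Induction on the length: drop the head v if the cycle passes through it, or
    the next vertex x if it passes through x.  Otherwise both are sources or
    sinks, and mutating at v makes the cycle pass through x; it is not oriented
    before or after. *)
Lemma chordless_parity C l w : totally_proper C -> l \in (C.2 : {set _}) ->
    chordless_cycle C.1 w ->
  cycle_parity (backward l C.1) w = oriented C.1 w.
Proof.
move: {2}(size w) (leqnn (size w)) => k; elim: k => [|k IH] in C l w *.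
  by case: w => // _ _ _ [].
have thrP C1 l1 v x s : (size (v :: x :: s) <= k.+1)%N -> totally_proper C1 ->
    l1 \in (C1.2 : {set _}) -> (4 <= size (v :: x :: s))%N ->
    chordless_cycle C1.1 (v :: x :: s) -> through C1.1 (last x s) v x ->
  cycle_parity (backward l1 C1.1) (v :: x :: s) = oriented C1.1 (v :: x :: s).
  move=> szk TP lC sz cyc thr; have [cyc' <-] := chordless_shortcut sz cyc thr.
  have [C' [l' [TP' EQ' l'C' <-]]] := shortcut_parity TP lC sz cyc thr.
  by rewrite -EQ'; apply: IH => //; rewrite EQ'.
move=> szk TP lC cyc; have Uw : uniq w by case: cyc => /and3P[].
case: w szk cyc Uw => [|v [|x [|y s]]] szk cyc Uw; try by case: cyc => /and3P[].
case: s szk cyc Uw => [|z s] szk cyc Uw.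
  by apply: triangle_parity => //; case: cyc.
have sz : (4 <= size [:: v, x, y, z & s])%N by [].
case: (boolP (through C.1 (last x [:: y, z & s]) v x)) => [|nthr].
  exact: thrP.
have cyc1 := chordless_cycle_rot 1 cyc.
rewrite -(cycle_parity_rot _ 1 Uw) -(oriented_rot _ 1).
case: (boolP (through C.1 v x y)) => [thr|nthr'].
  rewrite /rot /= in cyc1 *; apply: thrP => //=.
  - by rewrite size_cat /= addn1.
  - by rewrite size_cat /= addn1.
  - by rewrite last_cat.
have [vx pxs lv] := head_edges cyc.
have xy : edge C.1 x y by case/andP: pxs.
have [cycf nof] := chordless_flip sz cyc nthr.
have -> : oriented C.1 (rot 1 [:: v, x, y, z & s]) = false.
  rewrite oriented_rot; apply: contraNF nthr; rewrite /oriented /= !rcons_path.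
  rewrite /through => /orP[] /andP[-> /= /andP[_ /andP[_ /andP[_ ->]]]] //.
  by rewrite orbT.
have [C' [l' [TP' EQ' l'C' E]]] := flip_parity TP lC sz cyc nthr.
rewrite (cycle_parity_rot _ 1 Uw) -E -(cycle_parity_rot _ 1 Uw).
rewrite -EQ' in cycf nof.
rewrite -(negbTE nof) -(oriented_rot _ 1).
have := chordless_cycle_rot 1 cycf; rewrite /rot /= => cycf1.
apply: thrP => //=; rewrite ?size_cat /= ?addn1 //.
rewrite last_cat /= EQ' /through arrow_mutate_out arrow_mutate_in.
have ins p : p \in [:: x; y] -> p \in [:: x, y, z & s].
  by rewrite !inE => /orP[] -> //; rewrite orbT.
rewrite !(head_arrow_mutate cyc sz) ?ins ?inE ?eqxx ?orbT // 1?edge_sym //.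
move: nthr'; rewrite /through (edge_arrowN vx) (edge_arrowN xy).
by case: (arrow C.1 v x); case: (arrow C.1 x y).
Qed.

End Chordless.

(** * Quasi-Cartan companions *)

Section Companions.
Variable n : nat.
Implicit Types (C : coq n) (Q : quiver n) (u v w p q : 'I_n)
  (l : n.-tuple 'I_n) (g : rel 'I_n) (A : 'M[int]_n).

(** For g the order of a linear ordering, this is U + U^T with U the unipotent
    companion; for g switching equivalent to it, its conjugate by a diagonal
    matrix with entries 1 and -1. *)
Definition signed_companion Q g : 'M[int]_n := \matrix_(u, v)
  if u == v then 2 else if g u v then - exchange Q u v else exchange Q u v.

Lemma signed_companionE Q g u v : signed_companion Q g u v =
  if u == v then 2 else if g u v then - exchange Q u v else exchange Q u v.
Proof. by rewrite mxE. Qed.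

Lemma exchange_nonadjacent Q u v : ~~ edge Q u v -> exchange Q u v = 0.
Proof.
by rewrite /edge !arrow_exchange (exchange_anti _ u v) negb_or; lia.
Qed.

Lemma signed_companion_admissible C l g :
    totally_proper C -> l \in (C.2 : {set _}) ->
    switching (edge C.1) (before l) g ->
  admissible_companion C.1 (signed_companion C.1 g).
Proof.
move=> TP lC sw; have Ul := associated_uniq lC.
have g_anti u v : edge C.1 u v -> g v u = ~~ g u v.
  move=> uv; case: sw => h gE; rewrite !gE // 1?edge_sym //.
  by rewrite (before_anti Ul (edge_neq uv)) addNb addbC [h v (+) h u]addbC addbC.
split; first split.
- apply/matrixP => u v; rewrite mxE !signed_companionE eq_sym.
  case: eqVneq => // _; rewrite (exchange_anti _ u v) opprK.
  case: (boolP (edge C.1 u v)) => [/g_anti->|/exchange_nonadjacent->].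
    by case: (g u v).
  by rewrite oppr0 !if_same.
- by move=> v; rewrite signed_companionE eqxx.
- move=> v w /negbTE nvw; rewrite signed_companionE nvw.
  by case: ifP; [right | left].
move=> w cyc ch; have [/and3P[_ Uw Cw]] := cyc.
rewrite -(chordless_parity TP lC (conj cyc ch)).
rewrite /backward -(switching_cycle_parity (arrow C.1) Uw Cw sw).
rewrite /cycle_parity; congr odd; apply: eq_in_count => x xw.
have xn := next_cycle Cw xw; rewrite signed_companionE (negbTE (edge_neq xn)).
move: xn (edge_arrowN xn); rewrite /edge !arrow_exchange.
rewrite (exchange_anti _ x); case: (g x _); rewrite /= ?addbF ?addbT; lia.
Qed.

Lemma unipotent_companion_signed Q l (U : 'M[int]_n) : uniq l ->
  unipotent_companion Q l U -> U + U^T = signed_companion Q (before l).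
Proof.
move=> Ul [U1 U0 /matrixP UE]; apply/matrixP => u v; rewrite signed_companionE 2!mxE.
case: eqVneq => [->|nuv]; first by rewrite !U1.
have := UE u v; rewrite -[_ - _]/(U^T + - U) mxE [U^T u v]mxE [(- U) u v]mxE => <-.
case: ifP (before_anti Ul nuv) => [uv _ | _ vu].
  by rewrite (U0 v u uv) addr0 sub0r opprK.
by rewrite (U0 u v vu) add0r subr0.
Qed.

(** Column v of the matrix E in [mut_matrix Q v eps] = J + E. *)
Definition mut_column Q v (eps : int) p := Num.max 0 (- eps * exchange Q p v).

Lemma mut_matrix_mul Q v eps A p q : (mut_matrix Q v eps *m A) p q =
  (if p == v then -1 else 1) * A p q + mut_column Q v eps p * A v q.
Proof.
rewrite /mut_matrix mulmxDl [LHS]mxE [X in X + _]mxE [X in _ + X]mxE.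
congr (_ + _).
  rewrite (bigD1 p) //= mxE eqxx big1 ?addr0 // => i /negbTE ip.
  by rewrite mxE eq_sym ip mul0r.
rewrite (bigD1 v) //= mxE eqxx big1 ?addr0 // => i /negbTE iv.
by rewrite mxE iv mul0r.
Qed.

Lemma mut_matrix_conj Q v eps A p q :
  let J u : int := if u == v then -1 else 1 in let e := mut_column Q v eps in
  (mut_matrix Q v eps *m A *m (mut_matrix Q v eps)^T) p q =
  J q * (J p * A p q + e p * A v q) + e q * (J p * A p v + e p * A v v).
Proof.
move=> J e; rewrite -[_ *m _^T]trmxK trmx_mul trmxK mxE mut_matrix_mul.
by rewrite [_^T q p]mxE [_^T v p]mxE !mut_matrix_mul.
Qed.

(** Let x p = - eps * b_(p v) and A the signed companion.  A vertex p with
    x p > 0 is a tail; it has A_(p v) = - x p, and the new entry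
    - (A_(p v) + 2 x p) is the same, as it should be since both the arrow and
    the comparison between p and v get reversed.  For p, q distinct from v, the
    corrections to A_(p q) cancel when p and q are both tails.  For a tail p and
    a head q the correction is x p * A_(v q), up to sign the number of paths
    through v between p and q; as q lies on the same side of p and of v, this
    sign is the one that g prescribes. *)
Lemma mut_matrix_conj_signed Q v (b : bool) g g' :
    let eps : int := if b then -1 else 1 in
    let tail p := if b then arrow Q p v else arrow Q v p in
    let head p := if b then arrow Q v p else arrow Q p v in
    (forall p q, p != q -> g q p = ~~ g p q) ->
    (forall p q, p != q -> g' q p = ~~ g' p q) ->
    (forall p q, p != v -> q != v -> g' p q = g p q) ->
    (forall p, tail p -> g p v = b /\ g' p v = ~~ b) ->
    (forall p, head p -> g' p v = g p v) ->
    (forall p q, tail p -> head q -> g q p = g q v) ->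
  mut_matrix Q v eps *m signed_companion Q g *m (mut_matrix Q v eps)^T =
  signed_companion (mutate v Q) g'.
Proof.
move=> eps tail head g_anti g'_anti gg' tail_g head_g cross.
pose x p := - eps * exchange Q p v.
have tailE p : tail p = (0 < x p).
  rewrite /tail /x /eps; case: (b); rewrite arrow_exchange ?(exchange_anti _ p v);
  by rewrite ?opprK ?mul1r ?mulN1r.
have headE p : head p = (x p < 0).
  rewrite /head /x /eps; case: (b); rewrite arrow_exchange ?(exchange_anti _ p v);
  by rewrite ?opprK ?mul1r ?mulN1r ?oppr_gt0 ?oppr_lt0.
apply/matrixP => p q.
have xE u : exchange Q u v = - eps * x u by rewrite /x /eps; case: (b); lia.
have xE' u : exchange Q v u = eps * x u.
  by rewrite exchange_anti xE mulNr opprK.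
have xv : x v = 0 by rewrite /x mxE subrr mulr0.
have := (tail_g p, tail_g q, head_g p, head_g q).
rewrite !tailE !headE => -[[[posp posq] negp] negq].
rewrite mut_matrix_conj /mut_column !signed_companionE eqxx exchange_mutate.
rewrite !arrow_count -!/(x _) !xE !xE'.
case: (eqVneq p v) => [->|npv]; case: (eqVneq q v) => [->|nqv] /=.
- by rewrite xv; lia.
- rewrite !xE' xv (g_anti _ _ nqv) (g'_anti _ _ nqv).
  move: posq negq; rewrite /eps.
  case: (ltgtP 0 (x q)) => [xq /(_ isT)[-> ->] _|xq _ /(_ isT)->|x0 _ _].
  + by case: (b) => /=; lia.
  + by case: (b); case: (g q v) => /=; lia.
  + by case: (b); case: (g q v); case: (g' q v) => /=; lia.
- rewrite !xE xv (negbTE npv).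
  move: posp negp; rewrite /eps.
  case: (ltgtP 0 (x p)) => [xp /(_ isT)[-> ->] _|xp _ /(_ isT)->|x0 _ _].
  + by case: (b) => /=; lia.
  + by case: (b); case: (g p v) => /=; lia.
  + by case: (b); case: (g p v); case: (g' p v) => /=; lia.
rewrite gg' // !(g_anti _ _ nqv).
case: (eqVneq p q) => [<-|npq].
  move: posp; case: (ltP 0 (x p)) => [xp /(_ isT)[-> _]|xp _].
    by rewrite /eps; case: (b) => /=; lia.
  by lia.
move: (cross p q) (cross q p) posp posq; rewrite !tailE !headE (g_anti _ _ npq).
move: (exchange Q p q) (x p) (x q) (g p q) (g p v) (g q v) => z y y' c d d'.
rewrite /eps; clear.
have maxN (t : int) : Num.max 0 (- t) = Num.max 0 t - t by lia.
case: b; rewrite ?mulN1r ?opprK ?mul1r !maxN.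
all: case: (ltgtP 0 y) => ?; case: (ltgtP 0 y') => ? c1 c2 p1 p2.
all: try case: (p1 isT) => -> _; try case: (p2 isT) => -> _.
all: try move: (c1 isT isT); try move: (c2 isT isT); clear c1 c2 p1 p2.
all: by case: c; case: d; case: d' => //=; lia.
Qed.

(** With v last in l2, rotating l to l2 switches exactly the vertices that come
    before v in l.  Undoing this switching on the order l' of the mutated quiver
    gives the sign function g' of the congruent matrix, except that v has to be
    switched as well when b holds: v then jumps from above its in-neighbours to
    below them, whereas otherwise it jumps from below its out-neighbours to
    above them. *)
Lemma mut_companion_admissible Q (sigma : cyclic_ordering n) v l (b : bool) :
    totally_proper (Q, sigma) -> proper_vertex (Q, sigma) v ->
    l \in (sigma : {set _}) ->
    (forall u, (if b then arrow Q u v else arrow Q v u) -> before l u v = b) ->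
  let eps : int := if b then -1 else 1 in
  admissible_companion (mutate v Q)
    (mut_matrix Q v eps *m signed_companion Q (before l) *m (mut_matrix Q v eps)^T).
Proof.
move=> TP pv lS side eps; have Ul := associated_uniq lS.
have [sigma' [l2 [l' [[mut l2S] [l'S last2] agree outin [v_in out_v]]]]] :=
  mutation_exists pv.
have Ul2 := associated_uniq l2S; have Ul' := associated_uniq l'S.
have TP' : totally_proper (mutate v Q, sigma').
  by apply: totally_proper_class TP _; apply: rt_step; right; exists v.
have l2E p q : p != q -> p != v -> q != v ->
    before l2 p q = before l p q (+) (before l p v (+) before l q v).
  have [h hE] := associated_switching lS l2S.
  move=> npq np nq; have := last2 _ np; have := last2 _ nq; rewrite !hE //.
  move: (h p) (h q) (h v) => hp hq hv.
  by case: (before l p v); case: (before l q v); case: (before l p q);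
    case: hp; case: hq; case: hv.
pose h p := before l p v (+) (b && (p == v)).
pose g' p q := before l' p q (+) (h p (+) h q).
have hv : h v = b by rewrite /h /before ltnn eqxx andbT.
have hN p : p != v -> h p = before l p v.
  by move=> /negbTE np; rewrite /h np andbF addbF.
have g'_at p : p != v -> g' p v = before l' p v (+) (before l p v (+) b).
  by move=> np; rewrite /g' hv hN.
have in_neq p : arrow Q p v -> p != v.
  by apply: contraTneq => ->; rewrite arrowxx.
have out_neq p : arrow Q v p -> p != v.
  by apply: contraTneq => ->; rewrite arrowxx.
have in_v p : arrow Q p v -> before l' p v = false.
  by move=> pv'; rewrite (before_anti Ul' (_ : v != p)) 1?eq_sym ?in_neq ?v_in.
rewrite (@mut_matrix_conj_signed _ _ _ _ g').
- apply: (@signed_companion_admissible (mutate v Q, sigma') l') => //.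
  by exists h.
- by move=> p q; apply: before_anti.
- move=> p q npq; rewrite /g' (before_anti Ul' npq).
  by rewrite addNb addbC [h q (+) _]addbC addbC.
- move=> p q np nq; case: (eqVneq p q) => [->|npq].
    by rewrite /g' addbb addbF /before !ltnn.
  rewrite /g' agree // l2E // !hN //.
  by case: (before l p q); case: (before l p v); case: (before l q v).
- move=> p tail_p; have pl := side p tail_p; rewrite pl.
  case: (b) pl tail_p g'_at => pl pv' g'_at.
    by rewrite g'_at ?in_neq // in_v // pl.
  by rewrite g'_at ?out_neq // out_v // pl.
- move=> p; case: (b) g'_at => g'_at pv'.
    by rewrite g'_at ?out_neq // out_v //; case: (before l p v).
  by rewrite g'_at ?in_neq // in_v //; case: (before l p v).
move=> p q tail_p; have := side p tail_p; case: (b) tail_p => pq pl vq.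
  have npq : q != p by apply: contraTneq vq => ->; rewrite arrow_antisym.
  have := outin _ _ pq vq; rewrite l2E ?(in_neq p) ?(out_neq q) // pl.
  by case: (before l q p); case: (before l q v).
have npq : p != q by apply: contraTneq vq => <-; rewrite arrow_antisym.
have := outin _ _ vq pq; rewrite l2E ?(in_neq q) ?(out_neq p) // pl.
rewrite (before_anti Ul npq).
by case: (before l p q); case: (before l q v).
Qed.

End Companions.

Theorem corollary6p18 (n : nat) (Q : quiver n) (sigma : cyclic_ordering n)
    (vj : 'I_n) (l : n.-tuple 'I_n) (U : 'M[int]_n) :
  totally_proper (Q, sigma) ->
  proper_vertex (Q, sigma) vj ->
  l \in associated sigma ->
  unipotent_companion Q l U ->
  ((forall vi, vi \in In_ Q vj -> before l vi vj) ->
     admissible_companion (mutate vj Q)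
       (mut_matrix Q vj (-1) *m (U + U^T) *m (mut_matrix Q vj (-1))^T))
  /\
  ((forall vi, vi \in Out Q vj -> before l vj vi) ->
     admissible_companion (mutate vj Q)
       (mut_matrix Q vj 1 *m (U + U^T) *m (mut_matrix Q vj 1)^T)).
Proof.
move=> TP pv lS UU; have Ul := associated_uniq lS.
rewrite (unipotent_companion_signed Ul UU).
have main b := @mut_companion_admissible _ _ _ _ _ b TP pv lS.
split=> [In_before | Out_after]; [apply: (main true) | apply: (main false)] => u uv.
  by apply: In_before; rewrite inE.
have nu : vj != u by apply: contraTneq uv => ->; rewrite arrowxx.
by rewrite (before_anti Ul nu) Out_after // inE.
Qed.
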